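(* Let $\mathbb F$ be a field with $\mathrm{char}(\mathbb F)\ne2$ and let $n\ge3$. Let $\mathfrak q=(q_{ij})$ be a multiplicatively antisymmetric $n\times n$ matrix over $\mathbb F^\ast$ whose entries satisfy (i) $q_{ij}\ne q_{kl}$ for all $i<j$ and all $k<l$ with $(i,j)\ne(k,l)$; (ii) $q_{ij}q_{kl}\ne1$ for all $i<j$ and all $k<l$ with $(i,j)\ne(k,l)$. Then the group of linear automorphisms of the quantum affine space $\mathcal O_{\mathfrak q}(\mathbb F^n)$ coincides with the torus $(\mathbb F^\ast)^n$.
   Context: Multiplicatively antisymmetric means $q_{ii}=1$ and $q_{ji}=q_{ij}^{-1}$ for all $i,j$. The quantum affine space is $\mathcal O_{\mathfrak q}(\mathbb F^n)=\mathbb F\langle X_1,\dots,X_n\rangle/(X_iX_j-q_{ij}X_jX_i)$. An $\mathbb F$-automorphism $\sigma$ of it is called linear if $\sigma(X_i)=\sum_{j=1}^n\alpha_{ij}X_j$ for all $i$, with $(\alpha_{ij})\in\mathrm{GL}(n,\mathbb F)$. The torus $(\mathbb F^\ast)^n$ is identified with the group of automorphisms $X_i\mapsto a_iX_i$, $(a_1,\dots,a_n)\in(\mathbb F^\ast)^n$. *)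

(* Defs.v *)
From HB Require Import structures.
From mathcomp Require Import all_boot all_algebra.
From mathcomp Require Import boolp classical_sets.
From mathcomp.multinomials Require Import monalg.

Set Implicit Arguments.
Unset Strict Implicit.
Unset Printing Implicit Defensive.

Import GRing.Theory.
Local Open Scope ring_scope.
Local Open Scope quotient_scope.

(* Classical logic decides membership in the ideal of relations (the quotient
   needs a boolean predicate) and provides equality and inverses of
   automorphisms. *)

Definition mult_antisymmetric (F : fieldType) (n : nat) (q : 'M[F]_n) : Prop :=
  [/\ forall i j, q i j != 0,
      forall i, q i i = 1
    & forall i j, q j i = (q i j)^-1].

Inductive two_sided_ideal (R : pzRingType) (S : R -> Prop) : R -> Prop :=
| ideal_gen x : S x -> two_sided_ideal S x
| ideal_zero : two_sided_ideal S 0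
| ideal_add x y :
    two_sided_ideal S x -> two_sided_ideal S y -> two_sided_ideal S (x + y)
| ideal_mull a x : two_sided_ideal S x -> two_sided_ideal S (a * x)
| ideal_mulr a x : two_sided_ideal S x -> two_sided_ideal S (x * a).

(* F<X_1, ..., X_n>, as the algebra of the free monoid of words in 'I_n. *)
Definition free_alg (F : fieldType) (n : nat) : Type := {malg F[{fmonom 'I_n}]}.
HB.instance Definition _ (F : fieldType) (n : nat) :=
  GRing.Lalgebra.on (free_alg F n).

Definition free_gen (F : fieldType) (n : nat) (i : 'I_n) : free_alg F n :=
  mkmalgU (fmu i) 1.

Definition quantum_relation (F : fieldType) (n : nat) (q : 'M[F]_n)
    (x : free_alg F n) : Prop :=
  exists i j, x = free_gen F i * free_gen F j
                  - q i j *: (free_gen F j * free_gen F i).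

Definition quantum_ideal (F : fieldType) (n : nat) (q : 'M[F]_n) :
    {pred free_alg F n} :=
  fun x => `[< two_sided_ideal (quantum_relation q) x >].

Section FreeAlgebra.
Variables (F : fieldType) (n : nat).

Lemma free_alg_scalerAr (k : F) (x y : free_alg F n) :
  k *: (x * y) = x * (k *: y).
Proof.
have comm c : c%:MP * x = x * c%:MP.
  rewrite !malgM_def fgmulUg fgmulgU; apply: eq_bigr => m _.
  by rewrite mul1m mulm1 mulrC.
by rewrite -[LHS]mul_malgC -[k *: y]mul_malgC !mulrA comm.
Qed.
HB.instance Definition _ :=
  GRing.Lalgebra_isAlgebra.Build F (free_alg F n) free_alg_scalerAr.

Variables (B : algType F) (b : 'I_n -> B).

Definition word_eval (m : {fmonom 'I_n}) : B := \prod_(i <- m : seq 'I_n) b i.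

Lemma word_eval_mmorphism : mmorphism word_eval.
Proof.
by split=> [x y|]; rewrite /word_eval ?fmM ?big_cat //= fm1 big_nil.
Qed.
HB.instance Definition _ :=
  monalg.isMultiplicative.Build {fmonom 'I_n} B word_eval word_eval_mmorphism.

Definition free_eval (x : free_alg F n) : B := mmap (in_alg B) word_eval x.

Lemma free_eval_zmod : zmod_morphism free_eval.
Proof. by move=> x y; rewrite /free_eval raddfB. Qed.
HB.instance Definition _ :=
  GRing.isZmodMorphism.Build (free_alg F n) B free_eval free_eval_zmod.

Lemma free_eval_monoid : monoid_morphism free_eval.
Proof.
have [|M1 M2] := @commr_mmap_is_multiplicative {fmonom 'I_n} F B
    (in_alg B) word_eval.
  by move=> g m m'; rewrite /GRing.comm /= mulr_algl mulr_algr.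
by split=> // x y; apply: M1.
Qed.
HB.instance Definition _ :=
  GRing.isMonoidMorphism.Build (free_alg F n) B free_eval free_eval_monoid.

Lemma free_eval_scalable : scalable free_eval.
Proof. by move=> c x; rewrite /free_eval mmapZ /= mulr_algl. Qed.
HB.instance Definition _ :=
  GRing.isScalable.Build F (free_alg F n) B *:%R free_eval free_eval_scalable.

Lemma free_eval_gen i : free_eval (free_gen F i) = b i.
Proof.
by rewrite /free_eval /free_gen mmapU /= scale1r mul1r /word_eval fmU big_seq1.
Qed.

Lemma free_eval_ideal (q : 'M[F]_n) :
  (forall i j, b i * b j = q i j *: (b j * b i)) ->
  forall x, x \in quantum_ideal q -> free_eval x = 0.
Proof.
move=> bP x /asboolP; elim=> {x} [x [i [j ->]]||x y _ Hx _ Hy|a x _ Hx|a x _ Hx].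
- have e k l : free_eval (free_gen F k * free_gen F l) = b k * b l.
    by rewrite (free_eval_monoid.2 (free_gen F k)) !free_eval_gen.
  rewrite free_eval_zmod e (free_eval_scalable _ (free_gen F j * _)) e bP.
  exact: subrr.
- exact: raddf0.
- by rewrite raddfD /= Hx Hy addr0.
- by rewrite rmorphM /= Hx mulr0.
- by rewrite rmorphM /= Hx mul0r.
Qed.

End FreeAlgebra.

Section QuantumAffineSpace.
Variables (F : fieldType) (n : nat) (q : 'M[F]_n).

Let I := quantum_ideal q.

Lemma quantum_idealMl a x : x \in I -> a * x \in I.
Proof. by move=> /asboolP xI; apply/asboolP/ideal_mull. Qed.

Lemma quantum_idealMr a x : x \in I -> x * a \in I.
Proof. by move=> /asboolP xI; apply/asboolP/ideal_mulr. Qed.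

Lemma quantum_ideal_zmod : zmod_closed I.
Proof.
split=> [|x y xI yI]; first exact/asboolP/ideal_zero.
apply/asboolP/ideal_add; first exact/asboolP.
by rewrite -mulN1r; apply/asboolP/quantum_idealMl.
Qed.
HB.instance Definition _ :=
  GRing.isZmodClosed.Build (free_alg F n) (quantum_ideal q) quantum_ideal_zmod.

Definition quantum_affine : Type := {ideal_quot quantum_ideal q}.
HB.instance Definition _ := GRing.Zmodule.on quantum_affine.

Definition qa_pi (x : free_alg F n) : quantum_affine :=
  \pi_({ideal_quot quantum_ideal q}) x.
Definition qa_repr (x : quantum_affine) : free_alg F n :=
  repr (x : {ideal_quot quantum_ideal q}).

Lemma qa_reprK : cancel qa_repr qa_pi. Proof. exact: reprK. Qed.

Lemma qa_piP x y : (qa_pi x = qa_pi y) <-> (x - y \in quantum_ideal q).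
Proof.
by rewrite Quotient.idealrBE; split=> [H|/eqP //]; apply/eqP.
Qed.

Lemma qa_piD : {morph qa_pi : x y / x + y}.
Proof. by move=> x y; rewrite /qa_pi -raddfD. Qed.

Definition qa_one := qa_pi 1.
(* Locked so that conversion does not unfold the free algebra. *)
Definition qa_mul := locked (fun x y => qa_pi (qa_repr x * qa_repr y)).
Definition qa_scale := locked (fun (c : F) x => qa_pi (c *: qa_repr x)).

Lemma qa_pi_repr x : qa_repr (qa_pi x) - x \in quantum_ideal q.
Proof. by apply/qa_piP; rewrite qa_reprK. Qed.

Lemma qa_pi_mul x y : qa_pi (x * y) = qa_mul (qa_pi x) (qa_pi y).
Proof.
rewrite /qa_mul -lock.
apply/esym/qa_piP; set x' := qa_repr _; set y' := qa_repr _.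
have -> : x' * y' - x * y = (x' - x) * y' + x * (y' - y).
  by rewrite mulrBl mulrBr addrA subrK.
apply: rpredD; first exact/quantum_idealMr/qa_pi_repr.
exact/quantum_idealMl/qa_pi_repr.
Qed.

Lemma qa_pi_scale c x : qa_pi (c *: x) = qa_scale c (qa_pi x).
Proof.
rewrite /qa_scale -lock.
apply/esym/qa_piP; rewrite -scalerBr -mulr_algl.
exact/quantum_idealMl/qa_pi_repr.
Qed.

Lemma qa_mulA : associative qa_mul.
Proof.
move=> x y z; rewrite -[x]qa_reprK -[y]qa_reprK -[z]qa_reprK.
by rewrite -!qa_pi_mul mulrA.
Qed.

Lemma qa_mul1 : left_id qa_one qa_mul.
Proof. by move=> x; rewrite -[x]qa_reprK -qa_pi_mul mul1r. Qed.

Lemma qa_mulr1 : right_id qa_one qa_mul.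
Proof. by move=> x; rewrite -[x]qa_reprK -qa_pi_mul mulr1. Qed.

Lemma qa_mulDl : left_distributive qa_mul +%R.
Proof.
move=> x y z; rewrite -[x]qa_reprK -[y]qa_reprK -[z]qa_reprK.
by rewrite -qa_piD -!qa_pi_mul -qa_piD mulrDl.
Qed.

Lemma qa_mulDr : right_distributive qa_mul +%R.
Proof.
move=> x y z; rewrite -[x]qa_reprK -[y]qa_reprK -[z]qa_reprK.
by rewrite -qa_piD -!qa_pi_mul -qa_piD mulrDr.
Qed.

Lemma qa_pi0 : qa_pi 0 = 0. Proof. by rewrite /qa_pi raddf0. Qed.

Lemma qa_one_neq0 : qa_one != 0.
Proof.
apply/eqP; rewrite -qa_pi0 => /qa_piP; rewrite subr0.
move=> /(@free_eval_ideal _ _ F^o (fun=> 0)) H; apply/negP: (oner_neq0 F).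
rewrite negbK -(rmorph1 (@free_eval F n F^o (fun=> 0))); apply/eqP/H.
by move=> i j; rewrite mul0r scaler0.
Qed.

HB.instance Definition _ := GRing.Zmodule_isNzRing.Build quantum_affine
  qa_mulA qa_mul1 qa_mulr1 qa_mulDl qa_mulDr qa_one_neq0.

Lemma qa_scaleA a b x : qa_scale a (qa_scale b x) = qa_scale (a * b) x.
Proof. by rewrite -[x]qa_reprK -!qa_pi_scale scalerA. Qed.

Lemma qa_scale1 : left_id 1 qa_scale.
Proof. by move=> x; rewrite -[x]qa_reprK -qa_pi_scale scale1r. Qed.

Lemma qa_scaleDr : right_distributive qa_scale +%R.
Proof.
move=> c x y; rewrite -[x]qa_reprK -[y]qa_reprK.
by rewrite -qa_piD -!qa_pi_scale -qa_piD scalerDr.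
Qed.

Lemma qa_scaleDl x : {morph qa_scale^~ x : a b / a + b}.
Proof.
by move=> a b; rewrite -[x]qa_reprK -!qa_pi_scale -qa_piD scalerDl.
Qed.

HB.instance Definition _ := GRing.Zmodule_isLmodule.Build F quantum_affine
  qa_scaleA qa_scale1 qa_scaleDr qa_scaleDl.

Lemma qa_scaleAl (c : F) (x y : quantum_affine) : c *: (x * y) = (c *: x) * y.
Proof.
rewrite -[x]qa_reprK -[y]qa_reprK.
by rewrite -[_ * _]qa_pi_mul -[LHS]qa_pi_scale scalerAl qa_pi_mul qa_pi_scale.
Qed.

HB.instance Definition _ :=
  GRing.Lmodule_isLalgebra.Build F quantum_affine qa_scaleAl.

Lemma qa_scaleAr (c : F) (x y : quantum_affine) : c *: (x * y) = x * (c *: y).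
Proof.
rewrite -[x]qa_reprK -[y]qa_reprK.
by rewrite -[_ * _]qa_pi_mul -[LHS]qa_pi_scale scalerAr qa_pi_mul qa_pi_scale.
Qed.

HB.instance Definition _ :=
  GRing.Lalgebra_isAlgebra.Build F quantum_affine qa_scaleAr.

Lemma qa_pi_zmod : zmod_morphism qa_pi.
Proof. by move=> x y; rewrite /qa_pi raddfB. Qed.
HB.instance Definition _ :=
  GRing.isZmodMorphism.Build (free_alg F n) quantum_affine qa_pi qa_pi_zmod.

Lemma qa_pi_monoid : monoid_morphism qa_pi.
Proof. by split=> [|x y]; [|exact: qa_pi_mul]. Qed.
HB.instance Definition _ :=
  GRing.isMonoidMorphism.Build (free_alg F n) quantum_affine qa_pi qa_pi_monoid.

Lemma qa_pi_scalable : scalable qa_pi.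
Proof. by move=> c x; rewrite qa_pi_scale. Qed.
HB.instance Definition _ :=
  GRing.isScalable.Build F (free_alg F n) quantum_affine *:%R qa_pi
    qa_pi_scalable.

Definition qa_gen (i : 'I_n) : quantum_affine := qa_pi (free_gen F i).

Lemma qa_genM i j : qa_gen i * qa_gen j = q i j *: (qa_gen j * qa_gen i).
Proof.
rewrite /qa_gen -!rmorphM -linearZ; apply/qa_piP/asboolP.
by apply: ideal_gen; exists i, j.
Qed.

End QuantumAffineSpace.

Section UniversalProperty.
Variables (F : fieldType) (n : nat) (q : 'M[F]_n) (B : algType F).
Variable (b : 'I_n -> B).
Hypothesis bP : forall i j, b i * b j = q i j *: (b j * b i).

Definition qa_lift of (forall i j, b i * b j = q i j *: (b j * b i)) :
    quantum_affine q -> B :=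
  fun x => free_eval b (qa_repr x).
Local Notation lift := (qa_lift bP).

Lemma qa_lift_pi x : lift (qa_pi q x) = free_eval b x.
Proof.
apply/eqP; rewrite -subr_eq0 -raddfB /=; apply/eqP.
exact: free_eval_ideal bP _ (qa_pi_repr _ _).
Qed.

Lemma qa_lift_zmod : zmod_morphism lift.
Proof.
move=> x y; rewrite -[x]qa_reprK -[y]qa_reprK -raddfB !qa_lift_pi.
exact: raddfB.
Qed.
HB.instance Definition _ :=
  GRing.isZmodMorphism.Build (quantum_affine q) B lift qa_lift_zmod.

Lemma qa_lift_monoid : monoid_morphism lift.
Proof.
split=> [|x y]; first by rewrite -(rmorph1 (qa_pi q)) qa_lift_pi rmorph1.
rewrite -[x]qa_reprK -[y]qa_reprK -rmorphM !qa_lift_pi.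
exact: rmorphM.
Qed.
HB.instance Definition _ :=
  GRing.isMonoidMorphism.Build (quantum_affine q) B lift qa_lift_monoid.

Lemma qa_lift_scalable : scalable lift.
Proof.
move=> c x; rewrite -[x]qa_reprK -linearZ !qa_lift_pi.
exact: linearZ.
Qed.
HB.instance Definition _ :=
  GRing.isScalable.Build F (quantum_affine q) B *:%R lift qa_lift_scalable.

Lemma qa_lift_gen i : lift (qa_gen q i) = b i.
Proof. by rewrite qa_lift_pi free_eval_gen. Qed.

End UniversalProperty.

Lemma free_word (F : fieldType) (n : nat) (m : {fmonom 'I_n}) :
  mkmalgU m 1 = \prod_(i <- m : seq 'I_n) free_gen F i :> free_alg F n.
Proof.
case: m => s /=; elim: s => [|i s IH].
  by rewrite big_nil -fmoneE.
rewrite big_cons -IH malgM_def fgmulUU mulr1; congr mkmalgU.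
by apply: val_inj; rewrite /= fmM fmU.
Qed.

Lemma free_ext (F : fieldType) (n : nat) (B : algType F)
    (f g : {lrmorphism free_alg F n -> B}) :
  (forall i, f (free_gen F i) = g (free_gen F i)) -> f =1 g.
Proof.
move=> fg x; rewrite [x]monalgE !raddf_sum; apply: eq_bigr => m _ /=.
have -> : mkmalgU m x@_m = x@_m *: (mkmalgU m 1 : free_alg F n).
  by apply/malgP => k; rewrite mcoeffZ !mcoeffU mulrnAr mulr1.
rewrite !linearZ /= free_word !rmorph_prod; congr (_ *: _).
by apply: eq_bigr => i _; apply: fg.
Qed.

Lemma qa_ext (F : fieldType) (n : nat) (q : 'M[F]_n) (B : algType F)
    (f g : {lrmorphism quantum_affine q -> B}) :
  (forall i, f (qa_gen q i) = g (qa_gen q i)) -> f =1 g.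
Proof.
move=> fg x; rewrite -[x]qa_reprK.
exact: (free_ext (f := f \o qa_pi q) (g := g \o qa_pi q)).
Qed.

Section Automorphisms.
Variables (F : fieldType) (n : nat) (q : 'M[F]_n).
Local Notation A := (quantum_affine q).

Record qa_aut := QaAut {
  qa_aut_fun :> {lrmorphism A -> A};
  qa_aut_bij : bijective qa_aut_fun
}.

Lemma qa_autP (s t : qa_aut) : (s : A -> A) =1 t -> s = t.
Proof.
case: s t => [[f cf] sP] [[g cg] tP] /= /funext fg.
case: _ / fg in cg tP *.
case: cf cg sP tP => [[a] [b] [c]] [[a'] [b'] [c']].
rewrite (Prop_irrelevance a' a) (Prop_irrelevance b' b) (Prop_irrelevance c' c).
by move=> sP tP; rewrite (Prop_irrelevance sP tP).
Qed.

HB.instance Definition _ := gen_eqMixin qa_aut.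
HB.instance Definition _ := gen_choiceMixin qa_aut.

Definition qa_aut_one : qa_aut :=
  @QaAut (idfun : {lrmorphism A -> A}) (Bijective (frefl id) (frefl id)).

Definition qa_aut_mul (s t : qa_aut) : qa_aut :=
  @QaAut (s \o t : {lrmorphism A -> A})
    (bij_comp (qa_aut_bij s) (qa_aut_bij t)).

Section Inverse.
Variable s : qa_aut.

Fact qa_aut_inv_exists : {g : A -> A | cancel s g /\ cancel g s}.
Proof. by apply: cid; have [g sK gK] := qa_aut_bij s; exists g. Qed.

Definition qa_aut_inv_fun : A -> A := sval qa_aut_inv_exists.

Lemma qa_aut_invK : cancel s qa_aut_inv_fun.
Proof. exact: (svalP qa_aut_inv_exists).1. Qed.

Lemma qa_aut_Kinv : cancel qa_aut_inv_fun s.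
Proof. exact: (svalP qa_aut_inv_exists).2. Qed.

HB.instance Definition _ := GRing.isZmodMorphism.Build A A qa_aut_inv_fun
  (can2_zmod_morphism qa_aut_invK qa_aut_Kinv).
HB.instance Definition _ := GRing.isMonoidMorphism.Build A A qa_aut_inv_fun
  (can2_monoid_morphism qa_aut_invK qa_aut_Kinv).
HB.instance Definition _ := GRing.isScalable.Build F A A *:%R qa_aut_inv_fun
  (can2_scalable qa_aut_invK qa_aut_Kinv).

Definition qa_aut_inv : qa_aut :=
  @QaAut (qa_aut_inv_fun : {lrmorphism A -> A})
    (Bijective qa_aut_Kinv qa_aut_invK).

End Inverse.

Lemma qa_aut_mulA : associative qa_aut_mul.
Proof. by move=> s t u; apply: qa_autP. Qed.
Lemma qa_aut_mul1 : left_id qa_aut_one qa_aut_mul.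
Proof. by move=> s; apply: qa_autP. Qed.
Lemma qa_aut_mulr1 : right_id qa_aut_one qa_aut_mul.
Proof. by move=> s; apply: qa_autP. Qed.
Lemma qa_aut_mulV : left_inverse qa_aut_one qa_aut_inv qa_aut_mul.
Proof. by move=> s; apply: qa_autP => x /=; rewrite qa_aut_invK. Qed.
Lemma qa_aut_mulrV : right_inverse qa_aut_one qa_aut_inv qa_aut_mul.
Proof. by move=> s; apply: qa_autP => x /=; rewrite qa_aut_Kinv. Qed.

HB.instance Definition _ := isGroup.Build qa_aut
  qa_aut_mulA qa_aut_mul1 qa_aut_mulr1 qa_aut_mulV qa_aut_mulrV.

Lemma qa_autM (s t : qa_aut) x : (s * t)%g x = s (t x).
Proof. by []. Qed.

Definition linear_automorphisms : set qa_aut :=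
  [set s | exists2 alpha : 'M[F]_n, alpha \in unitmx &
     forall i, s (qa_gen q i) = \sum_(j < n) alpha i j *: qa_gen q j].

Lemma linear_combM (s : qa_aut) (alpha beta : 'M[F]_n) i :
    (forall i, s (qa_gen q i) = \sum_(j < n) alpha i j *: qa_gen q j) ->
  s (\sum_(j < n) beta i j *: qa_gen q j) =
  \sum_(k < n) (beta *m alpha) i k *: qa_gen q k.
Proof.
move=> sE; rewrite raddf_sum /=.
under eq_bigr => j _.
  rewrite linearZ /= sE scaler_sumr; over.
rewrite exchange_big; apply: eq_bigr => k _ /=; rewrite mxE scaler_suml.
by apply: eq_bigr => j _; rewrite scalerA.
Qed.

Lemma gen_comb1 i : \sum_(j < n) (1%:M : 'M[F]_n) i j *: qa_gen q j = qa_gen q i.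
Proof.
rewrite (bigD1 i) //= mxE eqxx scale1r big1 ?addr0 // => j ji.
by rewrite mxE eq_sym (negPf ji) scale0r.
Qed.

Lemma linear_automorphisms1 : linear_automorphisms 1%g.
Proof. by exists 1%:M => [|i]; rewrite ?unitmx1 ?gen_comb1. Qed.

Lemma linear_automorphismsM s t :
  linear_automorphisms s -> linear_automorphisms t ->
  linear_automorphisms (s * t)%g.
Proof.
move=> [alpha aU sE] [beta bU tE]; exists (beta *m alpha) => [|i].
  by rewrite unitmx_mul bU.
by rewrite qa_autM tE (linear_combM _ _ sE).
Qed.

Lemma linear_automorphismsV s :
  linear_automorphisms s -> linear_automorphisms s^-1%g.
Proof.
move=> [alpha aU sE]; exists (invmx alpha) => [|i]; first by rewrite unitmx_inv.
apply: (bij_inj (qa_aut_bij s)).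
by rewrite -qa_autM mulgV (linear_combM _ _ sE) mulVmx // gen_comb1.
Qed.

End Automorphisms.
Arguments linear_automorphisms {F n} q _.

Section Torus.
Variables (F : fieldType) (n : nat).

Definition torus_pred (a : {ffun 'I_n -> F}) := [forall i, a i != 0].

Record torus : Type := Torus {
  torus_val :> {ffun 'I_n -> F};
  torusP : torus_pred torus_val
}.
HB.instance Definition _ := [isSub for torus_val].
HB.instance Definition _ := [Choice of torus by <:].

Lemma torus_neq0 (a : torus) i : a i != 0.
Proof. exact: (forallP (torusP a)). Qed.

Lemma torus1_subproof : torus_pred [ffun=> 1].
Proof. by apply/forallP => i; rewrite ffunE oner_neq0. Qed.
Lemma torusM_subproof (a b : torus) : torus_pred [ffun i => a i * b i].
Proof. by apply/forallP => i; rewrite ffunE mulf_neq0 ?torus_neq0. Qed.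
Lemma torusV_subproof (a : torus) : torus_pred [ffun i => (a i)^-1].
Proof. by apply/forallP => i; rewrite ffunE invr_neq0 ?torus_neq0. Qed.

Definition torus_one := Torus torus1_subproof.
Definition torus_mul a b := Torus (torusM_subproof a b).
Definition torus_inv a := Torus (torusV_subproof a).

Lemma torus_mulA : associative torus_mul.
Proof.
by move=> a b c; apply: val_inj; apply/ffunP=> i; rewrite !ffunE mulrA.
Qed.
Lemma torus_mul1 : left_id torus_one torus_mul.
Proof. by move=> a; apply: val_inj; apply/ffunP=> i; rewrite !ffunE mul1r. Qed.
Lemma torus_mulr1 : right_id torus_one torus_mul.
Proof. by move=> a; apply: val_inj; apply/ffunP=> i; rewrite !ffunE mulr1. Qed.
Lemma torus_mulV : left_inverse torus_one torus_inv torus_mul.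
Proof.
move=> a; apply: val_inj; apply/ffunP=> i.
by rewrite !ffunE mulVf ?torus_neq0.
Qed.
Lemma torus_mulrV : right_inverse torus_one torus_inv torus_mul.
Proof.
move=> a; apply: val_inj; apply/ffunP=> i.
by rewrite !ffunE divff ?torus_neq0.
Qed.

HB.instance Definition _ := isGroup.Build torus
  torus_mulA torus_mul1 torus_mulr1 torus_mulV torus_mulrV.

Variable q : 'M[F]_n.

Lemma torus_relation (a : torus) i j :
  (a i *: qa_gen q i) * (a j *: qa_gen q j) =
  q i j *: ((a j *: qa_gen q j) * (a i *: qa_gen q i)).
Proof.
rewrite -!scalerAl -!scalerAr !scalerA qa_genM !scalerA.
by congr (_ *: _); rewrite mulrC mulrA mulrAC.
Qed.

Definition torus_fun (a : torus) : quantum_affine q -> quantum_affine q :=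
  qa_lift (torus_relation a).
HB.instance Definition _ a := GRing.LRMorphism.on (torus_fun a).

Lemma torus_fun_gen a i : torus_fun a (qa_gen q i) = a i *: qa_gen q i.
Proof. exact: qa_lift_gen. Qed.

Lemma torus_funM a b x : torus_fun (a * b)%g x = torus_fun a (torus_fun b x).
Proof.
apply: (qa_ext (f := torus_fun (a * b)%g)
               (g := torus_fun a \o torus_fun b)) => i /=.
by rewrite !torus_fun_gen linearZ /= torus_fun_gen scalerA ffunE mulrC.
Qed.

Lemma torus_fun1 x : torus_fun 1%g x = x.
Proof.
apply: (qa_ext (f := torus_fun 1%g) (g := idfun)) => i /=.
by rewrite torus_fun_gen ffunE scale1r.
Qed.

Lemma torus_funK a : cancel (torus_fun a) (torus_fun (a^-1)%g).
Proof. by move=> x; rewrite -torus_funM mulVg torus_fun1. Qed.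
Lemma torus_funVK a : cancel (torus_fun (a^-1)%g) (torus_fun a).
Proof. by move=> x; rewrite -torus_funM mulgV torus_fun1. Qed.

Definition torus_aut (a : torus) : qa_aut q :=
  @QaAut _ _ q (torus_fun a : {lrmorphism _ -> _})
    (Bijective (torus_funK a) (torus_funVK a)).

Lemma torus_aut_gen a i : torus_aut a (qa_gen q i) = a i *: qa_gen q i.
Proof. exact: torus_fun_gen. Qed.

Lemma torus_autM : {morph torus_aut : a b / (a * b)%g}.
Proof. by move=> a b; apply: qa_autP => x; apply: torus_funM. Qed.

(* X_i is nonzero: map it to a matrix unit of square zero and the other
   generators to 0. *)
Lemma qa_gen_neq0 i : qa_gen q i != 0.
Proof.
pose b j : 'M[F]_2 := (j == i)%:R *: delta_mx 0 1.
have b0 j k : b j * b k = 0.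
  rewrite /b -scalerAl -scalerAr -[_ * _]/(_ *m _) mul_delta_mx_0 //.
  by rewrite !scaler0.
have bP j k : b j * b k = q j k *: (b k * b j) by rewrite !b0 scaler0.
apply/eqP => /(congr1 (qa_lift bP)); rewrite qa_lift_gen raddf0.
move/matrixP/(_ 0 1); rewrite /b eqxx scale1r !mxE /= => /eqP.
by rewrite oner_eq0.
Qed.

Lemma torus_aut_inj : injective torus_aut.
Proof.
move=> a b ab; apply: val_inj; apply/ffunP => i /=.
have := congr1 (fun s : qa_aut q => s (qa_gen q i)) ab.
rewrite !torus_aut_gen => /eqP; rewrite -subr_eq0 -scalerBl scaler_eq0.
by rewrite (negPf (qa_gen_neq0 i)) orbF subr_eq0 => /eqP.
Qed.

End Torus.
Arguments torus_aut {F n} q a.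

(* Main.v *)
Require Import Defs.
From mathcomp Require Import all_boot all_algebra.
From mathcomp Require Import boolp classical_sets.
From mathcomp Require Import perm ring.

(** Let [s] be a linear automorphism with matrix [alpha].  Comparing
    coefficients in [s X_i * s X_j = q_ij * (s X_j * s X_i)] gives, for all [i],
    [j] and [k <> l],

    - [alpha_ik alpha_jk (1 - q_ij) = 0] (coefficient of [X_k^2]),
    - [alpha_ik alpha_jl (q_kl - q_ij) = alpha_il alpha_jk (q_ij q_kl - 1)]
      (coefficient of [X_k X_l]).

    Comparing coefficients normally requires the basis of ordered monomials.
    Here it is replaced by enough three-dimensional representations: the pairs
    of vectors [(c, d)] such that [X_i |-> c_i E_01 + d_i E_12] respects the
    relations.  Composing such a representation with [s] yields the
    representation of [(alpha c, alpha d)], so [alpha] preserves these pairs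
    ([relation_zero_image]); pairs supported on one or two coordinates give the
    two equations above ([alpha_square_coef], [alpha_mixed_coef]).

    The hypotheses on [q] say that for [i <> j] the value [q_ij] determines the
    unordered pair [{i, j}] ([q_entry_pair]); in particular at most one
    unordered pair has value 1.  As [\det alpha] is nonzero, some permutation
    [p] has all [alpha_(i, p i)] nonzero.  If [q_ij] is not 1, the square
    equations kill one side of the mixed equation for [(k, l) = (p i, p j)], so
    [q_(p i, p j) = q_ij] and [p] preserves [{i, j}]
    ([transversal_preserves_pair]).  Preserving all pairs but possibly one
    forces [p = 1] when [n >= 3], hence the diagonal of [alpha] has no zero
    ([alpha_diag_neq0]).  Finally, if [alpha_ij] were nonzero with [i <> j],
    then [q_ij = 1] and a third index [m] would satisfy [q_im = q_jm], which is
    excluded ([alpha_offdiag_eq0]). *)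

Import GRing.Theory.

Local Open Scope classical_set_scope.
Local Open Scope ring_scope.

(** These are the zeros of the multilinearised relations
    [x_i y_j - q_ij x_j y_i], that is, the truncated point modules of length 3
    of the quantum affine space, allowing [c] or [d] to be zero. *)
Definition relation_zero (F : fieldType) (n : nat) (q : 'M[F]_n)
    (c d : 'cV[F]_n) : Prop :=
  forall i j, c i 0 * d j 0 = q i j * (c j 0 * d i 0).

Definition step_mx (F : fieldType) (x y : F) : 'M[F]_3 :=
  x *: delta_mx 0 1 + y *: delta_mx 1 2.

Lemma step_mxM (F : fieldType) (x y x' y' : F) :
  step_mx F x y * step_mx F x' y' = (x * y') *: delta_mx 0 2.
Proof.
rewrite /step_mx mulrDl !mulrDr -!scalerAl -!scalerAr -![delta_mx _ _ * _]/(_ *m _).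
by rewrite !mul_delta_mx_cond /= !mulr0n mulr1n !scaler0 add0r !addr0 scalerA.
Qed.

Lemma relation_zero_image (F : fieldType) (n : nat) (q alpha : 'M[F]_n)
    (s : {lrmorphism quantum_affine q -> quantum_affine q}) :
    (forall i, s (qa_gen q i) = \sum_(j < n) alpha i j *: qa_gen q j) ->
  forall c d, relation_zero F n q c d ->
    relation_zero F n q (alpha *m c) (alpha *m d).
Proof.
move=> sE c d cd i j.
pose b k := step_mx F (c k 0) (d k 0).
have bP k l : b k * b l = q k l *: (b l * b k).
  by rewrite !step_mxM scalerA cd.
have sb k : qa_lift bP (s (qa_gen q k)) =
            step_mx F ((alpha *m c) k 0) ((alpha *m d) k 0).
  rewrite sE raddf_sum /= /step_mx !mxE !scaler_suml -big_split.
  apply: eq_bigr => l _ /=.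
  by rewrite linearZ /= qa_lift_gen scalerDr !scalerA.
have := congr1 (fun x => qa_lift bP (s x)) (qa_genM q i j).
rewrite !linearZ /= !rmorphM /= !sb !step_mxM scalerA.
by move/matrixP/(_ 0 2%R); rewrite !mxE /= !mulr1.
Qed.

Section PreservingMatrix.
Variables (F : fieldType) (n : nat) (q alpha : 'M[F]_n).
Hypothesis q_anti : mult_antisymmetric q.
Hypothesis alpha_zero : forall c d, relation_zero F n q c d ->
  relation_zero F n q (alpha *m c) (alpha *m d).

Lemma mulmx_col_pair k l x y i :
  (alpha *m (x *: delta_mx k 0 + y *: delta_mx l 0 : 'cV_n)) i 0 =
  x * alpha i k + y * alpha i l.
Proof. by rewrite mulmxDr -!scalemxAr -!colE !mxE. Qed.

(** The zero [(e_k, e_k)] isolates the coefficient of [X_k^2]. *)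
Lemma alpha_square_coef i j k :
  alpha i k * alpha j k = q i j * (alpha j k * alpha i k).
Proof.
have [_ q1 _] := q_anti.
have := alpha_zero (delta_mx k 0) (delta_mx k 0).
rewrite -!colE => /(_ _ i j); rewrite !mxE; apply=> a b; rewrite !mxE !andbT.
have [->|_] := eqVneq a k; have [->|_] := eqVneq b k;
  by rewrite ?q1 ?(mulr0, mul0r, mulr1).
Qed.

Lemma alpha_share_col i j k : alpha i k != 0 -> alpha j k != 0 -> q i j = 1.
Proof.
move=> ik jk; have := alpha_square_coef i j k.
rewrite [alpha j k * _]mulrC -{1}[_ * _]mul1r.
by move/(mulIf (mulf_neq0 ik jk)).
Qed.

(** The zero [(q_kl e_k + e_l, e_k + e_l)] involves [X_k^2], [X_l^2] and
    [X_k X_l]; the two square equations leave the last one. *)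
Lemma alpha_mixed_coef i j k l : k != l ->
  alpha i k * alpha j l * (q k l - q i j) =
  alpha i l * alpha j k * (q i j * q k l - 1).
Proof.
move=> kl; have [q0 q1 qV] := q_anti.
have lk : (l == k) = false by rewrite eq_sym (negPf kl).
have := alpha_zero (q k l *: delta_mx k 0 + 1 *: delta_mx l 0)
                   (1 *: delta_mx k 0 + 1 *: delta_mx l 0).
move=> /(_ _ i j); rewrite !mulmx_col_pair !mul1r => H.
have {}H : (q k l * alpha i k + alpha i l) * (alpha j k + alpha j l) =
           q i j * ((q k l * alpha j k + alpha j l) * (alpha i k + alpha i l)).
  apply: H => a b; rewrite !mxE !andbT !mul1r.
  pose simp := (mulr0, mul0r, mulr1, mul1r, addr0, add0r).
  have [->|ak] := eqVneq a k; have [->|bk] := eqVneq b k;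
    rewrite ?q1 ?(negPf kl) ?lk /= ?simp //.
  - by have [->|bl] := eqVneq b l; rewrite !simp.
  - have [->|al] := eqVneq a l; rewrite !simp //.
    by rewrite qV mulVf.
  - have [->|al] := eqVneq a l; have [->|bl] := eqVneq b l;
      by rewrite ?q1 /= !simp.
have sk := alpha_square_coef i j k; have sl := alpha_square_coef i j l.
apply/eqP; rewrite -subr_eq0; apply/eqP.
transitivity
  (((q k l * alpha i k + alpha i l) * (alpha j k + alpha j l) -
    q i j * ((q k l * alpha j k + alpha j l) * (alpha i k + alpha i l))) -
   q k l * (alpha i k * alpha j k - q i j * (alpha j k * alpha i k)) -
   (alpha i l * alpha j l - q i j * (alpha j l * alpha i l))); first by ring.
by rewrite H {1}sk {1}sl !subrr mulr0 !subr0.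
Qed.

Hypothesis n_ge3 : (3 <= n)%N.
Hypothesis q_neq : forall i j k l : 'I_n,
  (i < j)%N -> (k < l)%N -> (i, j) <> (k, l) -> q i j <> q k l.
Hypothesis q_mul_neq1 : forall i j k l : 'I_n,
  (i < j)%N -> (k < l)%N -> (i, j) <> (k, l) -> q i j * q k l <> 1.

(** Since [q_ji] is the inverse of [q_ij], the first hypothesis compares pairs
    listed in the same order and the second one pairs listed in opposite orders.
    Concluding about [k] only loses nothing: for [l], apply the lemma to
    [q j i = q l k]. *)
Lemma q_entry_pair (i j k l : 'I_n) :
  i != j -> k != l -> q i j = q k l -> (k == i) || (k == j).
Proof.
have [q0 _ qV] := q_anti.
suff main (a b c d : 'I_n) : (a < b)%N -> c != d -> q a b = q c d ->
    ((c == a) || (c == b)) && ((d == a) || (d == b)).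
  move=> ij kl e; have [lt|gt|/val_inj eij] := ltngtP i j.
  - by have /andP[] := main i j k l lt kl e.
  - have e' : q j i = q l k by rewrite qV e -qV.
    by rewrite eq_sym in kl; have /andP[_] := main j i l k gt kl e'; rewrite orbC.
  - by rewrite eij eqxx in ij.
move=> ab cd e; have [lt|gt|/val_inj ecd] := ltngtP c d.
- have [[-> ->]|ne] := pselect ((a, b) = (c, d)); first by rewrite !eqxx orbT.
  by have := q_neq _ _ _ _ ab lt ne.
- have [[-> ->]|ne] := pselect ((a, b) = (d, c)); first by rewrite !eqxx orbT.
  by case: (q_mul_neq1 _ _ _ _ ab gt ne); rewrite e qV mulVf.
- by rewrite ecd eqxx in cd.
Qed.

Lemma q_eq1_unique_partner (i j k : 'I_n) :
  i != j -> i != k -> j != k -> q i j = 1 -> q i k != 1.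
Proof.
move=> ij ik jk qij; apply/eqP => qik; have [_ _ qV] := q_anti.
have e : q i j = q k i by rewrite qij qV qik invr1.
rewrite eq_sym in ik; have := q_entry_pair _ _ _ _ ij ik e.
by rewrite (negPf ik) /= eq_sym (negPf jk).
Qed.

Lemma third_index (i j : 'I_n) : exists m : 'I_n, (i != m) && (j != m).
Proof.
suff /subsetPn[m _] : ~~ ([set: 'I_n] \subset [set i; j])%SET.
  by rewrite in_set2 negb_or => mij; exists m; rewrite ![_ == m]eq_sym.
apply/negP => /subset_leq_card; rewrite cardsT card_ord cards2 => le.
by have := leq_trans n_ge3 le; case: (i != j).
Qed.

(** When [q_ij] is not 1, the rows [i] and [j] of [alpha] have disjoint
    supports, so the right-hand side of the mixed equation vanishes. *)
Lemma transversal_preserves_pair i j k l :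
    i != j -> k != l -> alpha i k != 0 -> alpha j l != 0 -> q i j != 1 ->
  (k == i) || (k == j).
Proof.
move=> ij kl ik jl qij; apply: (q_entry_pair i j k l) => //.
have /eqP il : alpha i l == 0.
  by apply: contraNT qij => il; apply/eqP/(alpha_share_col i j l).
have := alpha_mixed_coef i j k l kl; rewrite il !mul0r => /eqP.
by rewrite mulf_eq0 (negPf (mulf_neq0 ik jl)) /= subr_eq0 => /eqP.
Qed.

Lemma alpha_diag_neq0 : alpha \in unitmx -> forall i, alpha i i != 0.
Proof.
rewrite unitmxE unitfE => det0.
have [p p0] : exists p : 'S_n, forall i, alpha i (p i) != 0.
  apply: contrapT => np; case/eqP: det0; apply: big1 => p _.
  have [i /eqP ai] : exists i, alpha i (p i) == 0.
    apply: contrapT => none; case: np; exists p => i.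
    by apply/negP => ai; apply: none; exists i.
  by rewrite (bigD1 i) //= ai mul0r mulr0.
have pair i j : i != j -> q i j != 1 -> (p i == i) || (p i == j).
  move=> ij; apply: (transversal_preserves_pair i j (p i) (p j)) => //.
  by rewrite (inj_eq perm_inj).
have [_ _ qV] := q_anti.
(* The index k lies outside the exceptional pair {i, j}, so p fixes k, and
   the pair {i, k} then forces p to fix i. *)
have exceptional i j k : i != j -> i != k -> j != k -> q i j = 1 -> p i = i.
  move=> ij ik jk qij; have ki : k != i by rewrite eq_sym.
  have kj : k != j by rewrite eq_sym.
  have ji : j != i by rewrite eq_sym.
  have qik : q i k != 1 by apply: q_eq1_unique_partner qij.
  have qji : q j i = 1 by rewrite qV qij invr1.
  have qjk : q j k != 1 by apply: q_eq1_unique_partner qji.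
  have pk : p k = k.
    have /orP[/eqP//|/eqP pki] : (p k == k) || (p k == i).
      by apply: pair; rewrite // qV invr_eq1.
    have : (p k == k) || (p k == j) by apply: pair; rewrite // qV invr_eq1.
    by rewrite pki (negPf ij) orbF => /eqP.
  have /orP[/eqP//|] : (p i == i) || (p i == k) by apply: pair.
  by rewrite -{1}pk (inj_eq perm_inj) (negPf ik).
move=> i; suff {2}<- : p i = i by [].
have [j /andP[ij _]] := third_index i i.
have [k /andP[ik jk]] := third_index i j.
have [qij|qij] := eqVneq (q i j) 1; first exact: (exceptional i j k).
have [qik|qik] := eqVneq (q i k) 1.
  by apply: (exceptional i k j) => //; rewrite eq_sym.
have /orP[/eqP//|/eqP pij] := pair i j ij qij.
by have := pair i k ik qik; rewrite pij (negPf jk) orbF => /eqP.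
Qed.

Lemma alpha_offdiag_eq0 : alpha \in unitmx ->
  forall i j, i != j -> alpha i j = 0.
Proof.
move=> aU i j ij; have diag := alpha_diag_neq0 aU.
apply/eqP/negPn/negP => aij.
have qij := alpha_share_col i j j aij (diag j).
have [m /andP[im jm]] := third_index i j.
have qim := q_eq1_unique_partner i j m ij im jm qij.
(* Row i meets column j and row m meets column m, although j is not in
   the pair {i, m}. *)
have := transversal_preserves_pair i m j m im jm aij (diag m) qim.
by rewrite eq_sym (negPf ij) (negPf jm).
Qed.

End PreservingMatrix.

Lemma torus_aut_linear (F : fieldType) (n : nat) (q : 'M[F]_n) (a : torus F n) :
  linear_automorphisms q (torus_aut q a).
Proof.
exists (diag_mx (\row_i a i)) => [|i].
  rewrite unitmxE det_diag unitfE; apply/prodf_neq0 => i _.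
  by rewrite mxE torus_neq0.
rewrite torus_aut_gen (bigD1 i) //= big1 => [|j ji]; rewrite !mxE.
  by rewrite eqxx addr0.
by rewrite eq_sym (negPf ji) scale0r.
Qed.

Theorem proposition4p1 (F : fieldType) (n : nat) (q : 'M[F]_n) :
    2%N \notin [pchar F] ->
    (3 <= n)%N ->
    mult_antisymmetric q ->
    (forall i j k l : 'I_n, (i < j)%N -> (k < l)%N -> (i, j) <> (k, l) ->
       q i j <> q k l) ->
    (forall i j k l : 'I_n, (i < j)%N -> (k < l)%N -> (i, j) <> (k, l) ->
       q i j * q k l <> 1) ->
  linear_automorphisms q = range (torus_aut q).
Proof.
move=> _ n3 qa qne qm; apply/seteqP; split=> s; last first.
  by case=> a _ <-; apply: torus_aut_linear.
case=> alpha aU sE; have az := relation_zero_image F n q alpha s sE.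
have diag := alpha_diag_neq0 F n q alpha qa az n3 qne qm aU.
have off := alpha_offdiag_eq0 F n q alpha qa az n3 qne qm aU.
have aP : torus_pred [ffun i => alpha i i] by apply/forallP => i; rewrite ffunE.
exists (Torus aP) => //; apply: qa_autP; apply: qa_ext => i.
rewrite torus_aut_gen sE /= ffunE (bigD1 i) //= big1 ?addr0 // => j ji.
by rewrite off ?scale0r // eq_sym.
Qed.
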